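(* Let $P$ be one of the following posets (the ''root posets of coincidental type''): (i) $\Phi^+(A_n)$ for some $n\geq 1$; (ii) $\Phi^+(B_n)$ for some $n\geq 1$; (iii) $\Phi^+(H_3)$; (iv) $\Phi^+(I_2(m))$ for some $m\geq 2$. Then the distributive lattice $J(P)$ is toggle CDE (tCDE).
   Context: All posets are finite. For a poset $P$, $J(P)$ is the set of order ideals (down-closed subsets) of $P$. For $I\in J(P)$, $\mathrm{ddeg}(I)$ is the number of elements of $J(P)$ covered by $I$ under inclusion, equivalently the number of maximal elements of $I$. For $p\in P$, the toggle $\tau_p\colon J(P)\to J(P)$ is $\tau_p(I)=I\cup\{p\}$ if $p\notin I$ and $I\cup\{p\}\in J(P)$; $\tau_p(I)=I\setminus\{p\}$ if $p\in I$ and $I\setminus\{p\}\in J(P)$; and $\tau_p(I)=I$ otherwise. Define $\mathcal{T}_{p^+}(I)=1$ if $I\subsetneq\tau_p(I)$ and $0$ otherwise; $\mathcal{T}_{p^-}(I)=1$ if $\tau_p(I)\subsetneq I$ and $0$ otherwise; and $\mathcal{T}_p=\mathcal{T}_{p^+}-\mathcal{T}_{p^-}$. A probability distribution $\mu$ on $J(P)$ is toggle-symmetric if $\mathbb{E}_\mu[\mathcal{T}_p]=0$ for every $p\in P$. $J(P)$ is tCDE if $\mathbb{E}_\mu[\mathrm{ddeg}]$ equals the average of $\mathrm{ddeg}$ over $J(P)$ under the uniform distribution, for every toggle-symmetric distribution $\mu$ on $J(P)$. The posets: $\Phi^+(A_n)$ has elements $(i,j)\in\mathbb{Z}^2$ with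 $1\leq i\leq j\leq n$, and $(i,j)\leq(i',j')$ iff $i'\leq i$ and $j\leq j'$. $\Phi^+(B_n)$ has elements $(i,j)\in\mathbb{Z}^2$ with $1\leq i\leq n$ and $i\leq j\leq 2n-i$, and $(i,j)\leq(i',j')$ iff $i'\leq i$ and $j'\leq j$. $\Phi^+(H_3)$ has $15$ elements $x_1,\ldots,x_{15}$, with partial order the transitive closure of the following cover relations: $x_4$ covers $x_1,x_2$; $x_5$ covers $x_2,x_3$; $x_6$ covers $x_4,x_5$; $x_7$ covers $x_5$; $x_8$ covers $x_6,x_7$; $x_9$ covers $x_7$; $x_{10}$ covers $x_8$; $x_{11}$ covers $x_8,x_9$; $x_{12}$ covers $x_{10},x_{11}$; $x_{13}$ covers $x_{12}$; $x_{14}$ covers $x_{13}$; $x_{15}$ covers $x_{14}$. $\Phi^+(I_2(m))$ has $m$ elements $a,b,c_1,\ldots,c_{m-2}$, where $a,b$ are incomparable, $c_1<c_2<\cdots<c_{m-2}$ is a chain, and (if $m\geq 3$) $a<c_1$ and $b<c_1$. *)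

(* Defs.v *)
From HB Require Import structures.
From mathcomp Require Import all_boot all_order all_algebra.
From mathcomp Require Import reals.

Set Implicit Arguments.
Unset Strict Implicit.
Unset Printing Implicit Defensive.

Import Order.TTheory GRing.Theory Num.Theory.

Section Ideals.
Context {d : Order.disp_t} {P : finPOrderType d}.

Definition is_ideal (I : {set P}) : bool :=
  [forall x in I, forall y, (y <= x)%O ==> (y \in I)].

Record ideal := Ideal { ideal_set :> {set P}; ideal_setP : is_ideal ideal_set }.

HB.instance Definition _ := [isSub for ideal_set].
HB.instance Definition _ := [Finite of ideal by <:].

Definition ideal_covered (K I : ideal) : bool :=
  (K \proper I) && ~~ [exists L : ideal, (K \proper L) && (L \proper I)].

Definition ddeg (I : ideal) : nat := #|[set K : ideal | ideal_covered K I]|.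

(* insubd I A is the ideal A when A is an ideal, and I otherwise *)
Definition toggle (p : P) (I : ideal) : ideal :=
  if p \in I then insubd I (I :\ p) else insubd I (p |: I).

End Ideals.

Arguments ideal {d} P.

Notation "''J' ( P )" := (ideal P) (at level 8, format "''J' ( P )") : type_scope.

Local Open Scope ring_scope.

Section ToggleSymmetry.
Context {R : realType} {d : Order.disp_t} {P : finPOrderType d}.

Definition toggle_plus (p : P) (I : 'J(P)) : R := (I \proper toggle p I)%:R.
Definition toggle_minus (p : P) (I : 'J(P)) : R := (toggle p I \proper I)%:R.
Definition toggleability (p : P) (I : 'J(P)) : R :=
  toggle_plus p I - toggle_minus p I.

Definition is_distribution (mu : 'J(P) -> R) : Prop :=
  (forall I, 0 <= mu I) /\ \sum_I mu I = 1.

Definition expectation (mu f : 'J(P) -> R) : R := \sum_I mu I * f I.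

Definition uniform (I : 'J(P)) : R := #|{: 'J(P)}|%:R^-1.

Definition toggle_symmetric (mu : 'J(P) -> R) : Prop :=
  forall p : P, expectation mu (toggleability p) = 0.

End ToggleSymmetry.

Definition tCDE (R : realType) (d : Order.disp_t) (P : finPOrderType d) : Prop :=
  forall mu : 'J(P) -> R, is_distribution mu -> toggle_symmetric mu ->
    expectation mu (fun I => (ddeg I)%:R) =
    expectation uniform (fun I : 'J(P) => (ddeg I)%:R).

Local Close Scope ring_scope.

Fact root_display : Order.disp_t. Proof. exact: (Order.Disp tt tt). Qed.

Section TypeA.
Variable n : nat.

(* the ordinal bounds leave room for the 1-based coordinates *)
Definition PhiA := {x : 'I_n.+1 * 'I_n.+1 | 1 <= x.1 <= x.2}.

HB.instance Definition _ := Finite.on PhiA.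

Definition leA (x y : PhiA) : bool :=
  ((val y).1 <= (val x).1) && ((val x).2 <= (val y).2).

Fact leA_refl : reflexive leA.
Proof. by move=> x; rewrite /leA !leqnn. Qed.

Fact leA_anti : antisymmetric leA.
Proof.
move=> [[a b] h] [[a' b'] h']; rewrite /leA /= => /andP[/andP[h1 h2] /andP[h3 h4]].
by apply/val_inj; congr pair; apply/val_inj/eqP; rewrite eqn_leq ?h1 ?h2 ?h3 ?h4.
Qed.

Fact leA_trans : transitive leA.
Proof.
move=> y x z /andP[h1 h2] /andP[h3 h4].
by rewrite /leA (leq_trans h3 h1) (leq_trans h2 h4).
Qed.

HB.instance Definition _ :=
  Order.Le_isPOrder.Build root_display PhiA leA_refl leA_anti leA_trans.

End TypeA.

Section TypeB.
Variable n : nat.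

Definition PhiB :=
  {x : 'I_n.+1 * 'I_(2 * n).+1 | (1 <= x.1) && (x.1 <= x.2 <= 2 * n - x.1)}.

HB.instance Definition _ := Finite.on PhiB.

Definition leB (x y : PhiB) : bool :=
  ((val y).1 <= (val x).1) && ((val y).2 <= (val x).2).

Fact leB_refl : reflexive leB.
Proof. by move=> x; rewrite /leB !leqnn. Qed.

Fact leB_anti : antisymmetric leB.
Proof.
move=> [[a b] h] [[a' b'] h']; rewrite /leB /= => /andP[/andP[h1 h2] /andP[h3 h4]].
by apply/val_inj; congr pair; apply/val_inj/eqP; rewrite eqn_leq ?h1 ?h2 ?h3 ?h4.
Qed.

Fact leB_trans : transitive leB.
Proof.
move=> y x z /andP[h1 h2] /andP[h3 h4].
by rewrite /leB (leq_trans h3 h1) (leq_trans h4 h2).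
Qed.

HB.instance Definition _ :=
  Order.Le_isPOrder.Build root_display PhiB leB_refl leB_anti leB_trans.

End TypeB.

(* the ordinal i : 'I_15 stands for x_(i+1) *)
Definition PhiH3 := 'I_15.

HB.instance Definition _ := Finite.on PhiH3.

(* (a, b) means that x_b covers x_a *)
Definition H3_cover_pairs : seq (nat * nat) :=
  [:: (1, 4); (2, 4); (2, 5); (3, 5); (4, 6); (5, 6); (5, 7); (6, 8); (7, 8);
      (7, 9); (8, 10); (8, 11); (9, 11); (10, 12); (11, 12); (12, 13);
      (13, 14); (14, 15)].

Definition H3_cover : rel PhiH3 :=
  fun x y => ((x : 'I_15).+1, (y : 'I_15).+1) \in H3_cover_pairs.

Definition leH3 : rel PhiH3 := connect H3_cover.

Fact leH3_refl : reflexive leH3.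
Proof. exact: connect0. Qed.

Fact leH3_leq (x y : PhiH3) : leH3 x y -> (x : 'I_15) <= (y : 'I_15).
Proof.
have cov (a b : PhiH3) : H3_cover a b -> (a : 'I_15) <= (b : 'I_15).
  rewrite /H3_cover => ab.
  have /allP/(_ _ ab) : all (fun u => u.1 <= u.2) H3_cover_pairs by [].
  by [].
move=> /connectP[s]; elim: s x => [|a s IH] x /=; first by move=> _ ->.
by move=> /andP[/cov xa /IH{}IH] /IH; apply: leq_trans.
Qed.

Fact leH3_anti : antisymmetric leH3.
Proof.
move=> x y /andP[/leH3_leq h1 /leH3_leq h2].
by apply/val_inj/eqP; rewrite eqn_leq h1 h2.
Qed.

Fact leH3_trans : transitive leH3.
Proof. exact: connect_trans. Qed.

HB.instance Definition _ :=
  Order.Le_isPOrder.Build root_display PhiH3 leH3_refl leH3_anti leH3_trans.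

Section TypeI2.
Variable m : nat.

(* a = inl false, b = inl true, c_(k+1) = inr k *)
Definition PhiI2 : Type := (bool + 'I_(m - 2))%type.

HB.instance Definition _ := Finite.on PhiI2.

Definition leI2 (x y : PhiI2) : bool :=
  match x, y with
  | inl u, inl v => u == v
  | inl _, inr _ => true
  | inr _, inl _ => false
  | inr k, inr l => k <= l
  end.

Fact leI2_refl : reflexive leI2.
Proof. by case=> u /=. Qed.

Fact leI2_anti : antisymmetric leI2.
Proof.
case=> u [] v //=; first by move=> /andP[/eqP ->].
by move=> uv; congr inr; apply/val_inj/eqP; rewrite eqn_leq.
Qed.

Fact leI2_trans : transitive leI2.
Proof.
case=> y [] x [] z //=; first by move=> /eqP -> /eqP ->.
exact: leq_trans.
Qed.

HB.instance Definition _ :=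
  Order.Le_isPOrder.Build root_display PhiI2 leI2_refl leI2_anti leI2_trans.

End TypeI2.

(* Main.v *)
Require Import Defs.
From mathcomp Require Import all_boot all_order all_algebra reals.
From mathcomp Require Import zify ring lra.

(* It suffices to write a * ddeg, with a nonzero, as a constant plus a linear
   combination of the toggleability statistics T_p: the uniform distribution is
   itself toggle-symmetric, because each toggle is an involution that negates
   T_p. In type A_n an ideal is a lattice path whose peaks are its maximal
   elements and whose valleys are the minimal elements of its complement. The
   second difference of the indicator of the region below the path is 1 at
   peaks and -1 at valleys; summed against the height it gives, by
   telescoping, 2 * ddeg = n + \sum_p (height p - 1) * T_p. An ideal of type
   B_n is a symmetric ideal of type A_(2n-1), and exactly one peak or valley
   lies on the symmetry axis, so the elements on the axis can be counted
   separately. The other two types are direct computations. *)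

Set Implicit Arguments.
Unset Strict Implicit.
Unset Printing Implicit Defensive.

Import Order.TTheory GRing.Theory Num.Theory.

(** * Toggles, and the maximal and minimal elements they act on *)

Section Toggles.
Context {d : Order.disp_t} {P : finPOrderType d}.
Implicit Types (p q : P) (I K : 'J(P)).

Definition removable p I : bool := (p \in I) && is_ideal (I :\ p).
Definition addable p I : bool := (p \notin I) && is_ideal (p |: I).

Lemma idealP (A : {set P}) :
  reflect (forall x y, x \in A -> (y <= x)%O -> y \in A) (is_ideal A).
Proof.
apply: (iffP forall_inP) => [h x y xA yx|h x xA].
  by have /forallP/(_ y)/implyP := h x xA; apply.
by apply/forallP => y; apply/implyP; apply: h.
Qed.

Lemma ideal_le I p q : p \in I -> (q <= p)%O -> q \in I.
Proof. exact/(idealP _ (ideal_setP I)). Qed.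

Lemma removableP p I :
  reflect (p \in I /\ forall q, q \in I -> (p <= q)%O -> q = p) (removable p I).
Proof.
apply: (iffP andP) => [[pI /idealP h]|[pI h]]; split=> //.
  move=> q qI pq; apply/eqP/negPn/negP => qp.
  by have := h q p; rewrite !inE qp qI eqxx => /(_ isT pq).
apply/idealP => x y; rewrite !inE => /andP[xp xI] yx.
rewrite (ideal_le xI yx) andbT; apply: contra_neq xp => yp.
by apply: h => //; rewrite -yp.
Qed.

Lemma addableP p I :
  reflect (p \notin I /\ forall q, (q <= p)%O -> q != p -> q \in I) (addable p I).
Proof.
apply: (iffP andP) => [[pI /idealP h]|[pI h]]; split=> //.
  move=> q qp nqp; have := h p q; rewrite !inE eqxx => /(_ isT qp).
  by rewrite (negPf nqp).
apply/idealP => x y; rewrite !inE => /orP[/eqP -> yp|xI yx].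
  by have [//|nyp] := eqVneq y p; apply: h.
by rewrite (ideal_le xI yx) orbT.
Qed.

Lemma ideal_set_toggle p I :
  ideal_set (toggle p I) =
  if removable p I then I :\ p else if addable p I then p |: I else I.
Proof.
rewrite /toggle /removable /addable; case: (p \in I) => /=;
  by rewrite /insubd; case: insubP => [u -> ->|/negPf ->].
Qed.

Lemma toggle_proper p I : (toggle p I \proper I) = removable p I.
Proof.
rewrite ideal_set_toggle; case: ifP => [/andP[pI _]|_]; first exact: properD1.
case: ifP => [/andP[pI _]|_]; last by rewrite properxx.
by apply/negP => /proper_sub/subsetP/(_ p (setU11 _ _)); apply/negP.
Qed.

Lemma proper_toggle p I : (I \proper toggle p I) = addable p I.
Proof.
rewrite ideal_set_toggle; case: ifP => [/andP[pI _]|_].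
  rewrite /addable pI; apply/negP => /proper_sub/subsetP/(_ p pI).
  by rewrite setD11.
case: ifP => [/andP[pI _]|_]; last by rewrite properxx.
by rewrite properUr // sub1set.
Qed.

Lemma toggleK p : involutive (toggle p).
Proof.
move=> I; apply: val_inj => /=; rewrite ideal_set_toggle.
rewrite /removable /addable ideal_set_toggle.
case nr: (removable p I).
  by have /andP[pI _] := nr; rewrite setD11 /= setD1K // (ideal_setP I).
case na: (addable p I).
  by have /andP[pI _] := na; rewrite setU11 setU1K // (ideal_setP I).
by rewrite -/(removable p I) -/(addable p I) nr na.
Qed.

(** Lower covers are exactly the ideals got by deleting a maximal element. Deleting one element
    leaves no room for an ideal in between; conversely, if [I] covers [K], deleting a maximal
    element of [I] outside [K] gives an ideal containing [K], hence [K] itself. *)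
Lemma ddegE I : ddeg I = #|[set p | removable p I]|.
Proof.
have injD : {in [set p | removable p I] &, injective (toggle^~ I)}.
  move=> p q; rewrite !inE => rp rq /(congr1 (fun K : 'J(P) => p \in K)).
  rewrite !ideal_set_toggle rp rq setD11 !inE.
  by have /andP[-> _] := rp; rewrite andbT => /esym/negbFE/eqP.
rewrite -(card_in_imset injD) /ddeg; congr #|pred_of_set _|.
apply/setP => K; rewrite inE; apply/andP/imsetP => [[KI noL]|[p]]; last first.
  rewrite inE => rp ->; rewrite toggle_proper rp; split=> //.
  apply/existsP => -[L /andP[/proper_card + /proper_card]].
  have /andP[pI _] := rp; rewrite ideal_set_toggle rp [#|I|](cardsD1 p) pI.
  by lia.
have [/subsetP KIs [x0 x0I x0K]] := properP KI.
(* An element of [I] outside [K] with fewest elements of [I] above it is maximal in [I]: anything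
   above it in [I] is again outside [K], as [K] is down-closed. *)
pose dn x := #|[set y in I | (x <= y)%O]|.
have x0IK : x0 \in I :\: K by rewrite inE x0K.
have := @arg_minnP _ x0 (mem (I :\: K)) dn x0IK.
case=> p; rewrite !inE => /andP[pK pI] pmin.
have rp : removable p I.
  apply/removableP; split=> // q qI pq; apply/eqP; rewrite eq_le pq andbT.
  have qK : q \notin K by apply: contra pK => qK; apply: ideal_le qK pq.
  have := pmin q; rewrite !inE qK qI => /(_ isT) dnle.
  have sub : [set y in I | (q <= y)%O] \subset [set y in I | (p <= y)%O].
    apply/subsetP => y; rewrite !inE => /andP[-> qy]; exact: le_trans pq qy.
  have /eqP/setP/(_ p) : [set y in I | (q <= y)%O] == [set y in I | (p <= y)%O].
    by rewrite eqEcard sub.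
  by rewrite !inE pI lexx.
exists p; rewrite ?inE //; apply/val_inj => /=; apply/eqP.
have KD : K \subset toggle p I.
  rewrite ideal_set_toggle rp; apply/subsetP => y yK; rewrite !inE KIs // andbT.
  by apply: contraNneq pK => <-.
rewrite eqEsubset KD; apply: contraR noL => nDK.
by apply/existsP; exists (toggle p I); rewrite properE KD nDK toggle_proper.
Qed.
End Toggles.

Local Open Scope ring_scope.

(** * A linear criterion for tCDE *)

Section Criterion.
Context {R : realType} {d : Order.disp_t} {P : finPOrderType d}.

Lemma toggleabilityE (p : P) (I : 'J(P)) :
  toggleability p I = (addable p I)%:R - (removable p I)%:R :> R.
Proof.
by rewrite /toggleability /toggle_plus proper_toggle /toggle_minus toggle_proper.
Qed.

Lemma natr_ddeg (I : 'J(P)) : (ddeg I)%:R = \sum_p (removable p I)%:R :> R.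
Proof.
rewrite ddegE -sum1_card natr_sum big_mkcond /=.
by apply: eq_bigr => p _; rewrite inE; case: removable.
Qed.

Lemma uniform_distribution : is_distribution (@uniform R d P).
Proof.
have ideal0 : is_ideal (set0 : {set P}) by apply/idealP => x y; rewrite inE.
split=> [I|]; first by rewrite invr_ge0 ler0n.
rewrite sumr_const -[LHS]mulr_natl mulfV // pnatr_eq0 -lt0n.
by apply/card_gt0P; exists (Ideal ideal0).
Qed.

Lemma uniform_toggle_symmetric : toggle_symmetric (@uniform R d P).
Proof.
move=> p; rewrite /expectation -mulr_sumr.
have : \sum_I toggleability p I = - (\sum_I toggleability p I) :> R.
  rewrite {1}(reindex_inj (inv_inj (toggleK p))) -sumrN.
  apply: eq_bigr => I _; rewrite /toggleability /toggle_plus /toggle_minus.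
  by rewrite toggleK opprB.
by move=> h; rewrite (_ : \sum_I _ = 0) ?mulr0 //; lra.
Qed.

(** Averaged against a toggle-symmetric [mu], the toggle terms vanish, so the expectation of [ddeg]
    is [b / a] whatever [mu] is; the uniform distribution is one such [mu]. *)
Lemma tCDE_criterion (a b : R) (c : P -> R) : a != 0 ->
  (forall I : 'J(P), a * \sum_p (removable p I)%:R =
     b + \sum_p c p * ((addable p I)%:R - (removable p I)%:R)) ->
  tCDE R P.
Proof.
move=> a0 h.
have E (mu : 'J(P) -> R) : is_distribution mu -> toggle_symmetric mu ->
    expectation mu (fun I => (ddeg I)%:R) = b / a.
  move=> [_ mu1] mus; apply: (mulfI a0); rewrite mulrCA mulfV // mulr1.
  rewrite /expectation mulr_sumr.
  under eq_bigr => I _ do rewrite mulrCA natr_ddeg h mulrDr.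
  rewrite big_split /= -mulr_suml mu1 mul1r.
  under eq_bigr => I _ do rewrite mulr_sumr.
  rewrite exchange_big big1 ?addr0 //= => p _.
  under eq_bigr => I _ do rewrite mulrCA -toggleabilityE.
  by rewrite -mulr_sumr [X in _ * X]mus mulr0.
move=> mu mud mus; rewrite !E //.
  exact: uniform_distribution.
exact: uniform_toggle_symmetric.
Qed.
End Criterion.

(** * Type I_2 *)

Lemma leI2E m (x y : PhiI2 m) : (x <= y)%O = Defs.leI2 x y.
Proof. by []. Qed.

(** The identity is 2 ddeg = 2 - T_a - T_b. If [I] meets the chain, then T_a = T_b = 0 and the
    largest c_k in [I] is its only maximal element. Otherwise [I] is a subset of {a, b}, and ddeg is
    its size. *)
Lemma tCDE_I2 (R : realType) m : tCDE R (PhiI2 m).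
Proof.
pose c (p : PhiI2 m) : R := if p is inl _ then -1 else 0.
apply: (@tCDE_criterion R _ _ 2 2 c); first by rewrite pnatr_eq0.
move=> I; rewrite !big_sumType /= !big_bool /= [\sum_i 0 * _]big1 => [|i _];
  last by rewrite mul0r.
have [/existsP[k0 k0I]|/existsPn noI] := boolP [exists k, inr k \in I].
  have abI u : inl u \in I by apply: ideal_le k0I _.
  have ab_rem u : removable (inl u : PhiI2 m) I = false.
    by apply/negP => /removableP[_ /(_ _ k0I)]; rewrite leI2E => /(_ isT).
  have ab_add u : addable (inl u : PhiI2 m) I = false.
    by rewrite /addable abI.
  have [k kI kmax] := @arg_maxnP _ k0 [pred k | inr k \in I] val k0I.
  rewrite !ab_rem !ab_add (bigD1 k) //= big1 => [|l lk].
    have -> : removable (inr k : PhiI2 m) I.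
      apply/removableP; split=> // -[u|l]; rewrite leI2E //= => lI kl.
      congr inr; apply/val_inj/eqP; rewrite eqn_leq kl andbT; exact: kmax.
    by rewrite /c /=; ring.
  suff -> : removable (inr l : PhiI2 m) I = false by [].
  apply/negP => /removableP[lI /(_ _ kI)]; rewrite leI2E /=.
  by move=> /(_ (kmax l lI)) [kl]; rewrite kl eqxx in lk.
rewrite big1 => [|k _]; last by rewrite /removable (negPf (noI k)).
have remE u : removable (inl u : PhiI2 m) I = (inl u \in I).
  apply/removableP/idP => [[]//|uI]; split=> // -[v|k] qI; rewrite leI2E /=.
    by move=> /eqP ->.
  by have := noI k; rewrite qI.
have addE u : addable (inl u : PhiI2 m) I = (inl u \notin I).
  apply/addableP/idP => [[]//|uI]; split=> // -[v|k]; rewrite leI2E //=.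
  by move=> /eqP ->; rewrite eqxx.
rewrite !remE !addE.
by rewrite /c; case: (inl true \in I); case: (inl false \in I) => /=; ring.
Qed.

(** * Type H_3 *)

(** Maximality and minimality are tested on cover relations only, for a membership function of the
    labels 1 to 15, so that the identity becomes a finite case analysis. *)
Definition H3_removable (f : nat -> bool) (p : nat) : bool :=
  f p && all (fun u => (u.1 == p) ==> ~~ f u.2) H3_cover_pairs.
Definition H3_addable (f : nat -> bool) (p : nat) : bool :=
  ~~ f p && all (fun u => (u.2 == p) ==> f u.1) H3_cover_pairs.

(* The solution of the linear system with one equation for each of the 32 order
   ideals. *)
Definition H3_coef (R : realType) : seq R :=
  [:: -1; -1; -1; 0; 0; 1; 0; 2; 0; 1; 2; 4; 3; 2; 1].

Lemma H3_identity (R : realType) (f : nat -> bool) :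
  all (fun u => f u.2 ==> f u.1) H3_cover_pairs ->
  2 * \sum_(p < 15) (H3_removable f p.+1)%:R =
  3 + \sum_(p < 15) (H3_coef R)`_p *
        ((H3_addable f p.+1)%:R - (H3_removable f p.+1)%:R) :> R.
Proof.
rewrite -(big_mkord xpredT (fun p => (H3_removable f p.+1)%:R)).
rewrite -(big_mkord xpredT (fun p => (H3_coef R)`_p *
        ((H3_addable f p.+1)%:R - (H3_removable f p.+1)%:R))).
rewrite unlock /H3_removable /H3_addable /=.
(* The cover pairs are listed by nondecreasing upper label, so each [//=] prunes the non-ideals as
   soon as a label is decided. *)
case: (f 1); case: (f 2); case: (f 3); case: (f 4) => //=;
case: (f 5) => //=; case: (f 6) => //=; case: (f 7) => //=;
case: (f 8) => //=; case: (f 9) => //=; case: (f 10) => //=;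
case: (f 11) => //=; case: (f 12) => //=; case: (f 13) => //=;
case: (f 14) => //=; case: (f 15) => //= _; ring.
Qed.

Lemma H3_cover_le (x y : PhiH3) : H3_cover x y -> (x <= y)%O.
Proof. exact: connect1. Qed.

Lemma H3_cover_neq (x y : PhiH3) : H3_cover x y -> x != y.
Proof.
rewrite /H3_cover => xy.
have /allP/(_ _ xy) : all (fun u => u.1 < u.2)%N H3_cover_pairs by [].
by apply: contraTneq => ->; rewrite ltnn.
Qed.

(** This and the next lemma reduce maximality in an ideal and minimality outside it to the cover
    relations. *)
Lemma leH3_first_cover (x y : PhiH3) : (x <= y)%O -> x != y ->
  exists2 z, H3_cover x z & (z <= y)%O.
Proof.
move=> /connectP[[|z s] /= sP ->]; first by rewrite eqxx.
by case/andP: sP => xz sP _; exists z => //; apply/connectP; exists s.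
Qed.

Lemma leH3_last_cover (x y : PhiH3) : (x <= y)%O -> x != y ->
  exists2 z, H3_cover z y & (x <= z)%O.
Proof.
move=> /connectP[s]; case/lastP: s => [|s z] /=; first by move=> _ ->; rewrite eqxx.
rewrite last_rcons rcons_path => /andP[sP zy] -> _.
by exists (last x s) => //; apply/connectP; exists s.
Qed.

Lemma H3_pairs_cover (u : nat * nat) : u \in H3_cover_pairs ->
  exists x y : PhiH3, u = ((x : 'I_15).+1, (y : 'I_15).+1) /\ H3_cover x y.
Proof.
have bounds : all (fun u => (0 < u.1 <= 15) && (0 < u.2 <= 15))%N H3_cover_pairs.
  by [].
move=> uP; have := allP bounds _ uP.
case: u uP => -[|a] [|b] //= uP; rewrite ?andbF // => /andP[aP bP].
by exists (Ordinal aP), (Ordinal bP).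
Qed.

Lemma tCDE_H3 (R : realType) : tCDE R PhiH3.
Proof.
apply: (@tCDE_criterion R _ PhiH3 2 3 (fun p : 'I_15 => (H3_coef R)`_p)).
  by rewrite pnatr_eq0.
move=> I; pose f k := (inord k.-1 : PhiH3) \in I.
have fE (p : PhiH3) : f (p : 'I_15).+1 = (p \in I) by rewrite /f inord_val.
have remE (p : PhiH3) : removable p I = H3_removable f (p : 'I_15).+1.
  apply/removableP/andP => [[pI pmax]|[pI /allP pmax]]; rewrite fE in pI *.
    split=> //; apply/allP => u /H3_pairs_cover[x [y [-> /= xy]]].
    apply/implyP => /eqP[/val_inj xp]; rewrite xp in xy; rewrite fE.
    apply: contraTN (H3_cover_neq xy) => /pmax/(_ (H3_cover_le xy)) ->.
    by rewrite eqxx.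
  split=> // q qI pq; apply/eqP; rewrite eq_sym; apply/negPn/negP => npq.
  have [z pz zq] := leH3_first_cover pq npq.
  by have := pmax _ pz; rewrite /= eqxx fE (ideal_le qI zq).
have addE (p : PhiH3) : addable p I = H3_addable f (p : 'I_15).+1.
  apply/addableP/andP => [[pI pmin]|[pI /allP pmin]]; rewrite fE in pI *.
    split=> //; apply/allP => u /H3_pairs_cover[x [y [-> /= xy]]].
    apply/implyP => /eqP[/val_inj yp]; rewrite yp in xy; rewrite fE.
    exact: pmin (H3_cover_le xy) (H3_cover_neq xy).
  split=> // q qp nqp; have [z zp qz] := leH3_last_cover qp nqp.
  by have := pmin _ zp; rewrite /= eqxx fE => zI; apply: ideal_le zI qz.
under eq_bigr => p _ do rewrite remE.
under [in RHS]eq_bigr => p _ do rewrite remE addE.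
apply: H3_identity; apply/allP => u /H3_pairs_cover[x [y [-> /= xy]]].
by rewrite !fE; apply/implyP => yI; apply: ideal_le yI (H3_cover_le xy).
Qed.

(** * Corners of regions in a staircase *)

(** Coordinates decrease as one goes up in the poset, so a region is closed under increasing them,
    and a peak has both predecessor cells outside. Since [0.-1] is 0, no peak has a zero
    coordinate. *)
Definition peak (f : nat -> nat -> bool) i k : bool :=
  [&& f i k, ~~ f i.-1 k & ~~ f i k.-1].
Definition valley (f : nat -> nat -> bool) i k : bool :=
  [&& ~~ f i k, f i.+1 k & f i k.+1].

Section Staircase.
Variables (R : realType) (N : nat) (f : nat -> nat -> bool).

(** The cells left free are those with i, k > 0 and i + k <= N + 1, a copy of the poset of type A_N.
    Empty axes and a filled far side fix both ends of the path. *)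
Definition staircase_region : Prop :=
  [/\ forall k, f 0 k = false, forall i, f i 0 = false,
      forall i k i' k', (i <= i')%N -> (k <= k')%N -> f i k -> f i' k' &
      forall i k, (0 < i)%N -> (0 < k)%N -> (N.+1 < i + k)%N -> f i k].

Hypothesis fP : staircase_region.

(** The right side is the mixed second difference on a unit square. Of the six monotone patterns
    there, only the peak and the valley make it nonzero. *)
Lemma peak_sub_valley i k :
  (peak f i.+1 k.+1)%:R - (valley f i k)%:R =
  ((f i.+1 k.+1)%:R - (f i.+1 k)%:R) - ((f i k.+1)%:R - (f i k)%:R) :> R.
Proof.
have [_ _ mono _] := fP; rewrite /peak /valley /=.
have := mono i k i.+1 k (leqnSn _) (leqnn _).
have := mono i k i k.+1 (leqnn _) (leqnSn _).
have := mono i k.+1 i.+1 k.+1 (leqnSn _) (leqnn _).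
have := mono i.+1 k i.+1 k.+1 (leqnn _) (leqnSn _).
case: (f i k); case: (f i.+1 k); case: (f i k.+1); case: (f i.+1 k.+1) => //=;
  do ?[move=> /(_ isT) //|move=> _]; ring.
Qed.

(** This is 2 peak + (N - i - k) (peak - valley), where N - i - k is the height minus one, with
    height 0 at minimal elements. A peak at (i+1, k+1) and a valley at (i, k) get equal weights, so
    they pair into a second difference. *)
Definition staircase_term i k : R :=
  (N.+2%:R - i%:R - k%:R) * (peak f i k)%:R -
  (N%:R - i%:R - k%:R) * (valley f i k)%:R.

(** Outside the staircase peaks can occur only on i + k = N + 2, where their weight is 0; the forced
    values of [f] exclude every other corner. *)
Lemma staircase_term_out i k : ~~ [&& (0 < i)%N, (0 < k)%N & (i + k <= N.+1)%N] ->
  staircase_term i k = 0.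
Proof.
have [f0 f1 _ fbig] := fP; rewrite /staircase_term /peak /valley.
case: i => [|i]; first by rewrite !f0 ?andbF /= !mulr0 subr0.
case: k => [|k]; first by rewrite !f1 ?andbF /= !mulr0 subr0.
rewrite /= -ltnNge => ik; rewrite [f i.+1 k.+1]fbig //= mulr0 subr0.
have [ikN|ikN] := eqVneq (i.+1 + k.+1)%N N.+2.
  by rewrite -ikN natrD; ring.
case: i ik ikN => [|i] ik ikN; last by rewrite [f i.+1 _]fbig ?mulr0 //; lia.
by case: k ik ikN => [|k] ik ikN; last rewrite [f _ k.+1]fbig ?andbF ?mulr0 //; lia.
Qed.

(** By telescoping, this compares how often the path crosses rows i + 1 and i: once in a positive
    row, never in row 0. *)
Lemma sum_peak_sub_valley_row i : (i <= N)%N ->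
  \sum_(0 <= k < N.+1) ((peak f i.+1 k.+1)%:R - (valley f i k)%:R)
  = (i == 0%N)%:R :> R.
Proof.
have [f0 f1 _ fbig] := fP => iN.
under eq_bigr => k _ do rewrite peak_sub_valley.
rewrite sumrB !telescope_sumr // !f1 [f i.+1 _]fbig //; last by lia.
case: i iN => [|i] iN; first by rewrite f0 !subr0.
by rewrite [f i.+1 _]fbig ?subrr //; lia.
Qed.

Lemma sum_peak_sub_valley_col k : (k <= N)%N ->
  \sum_(0 <= i < N.+1) ((peak f i.+1 k.+1)%:R - (valley f i k)%:R)
  = (k == 0%N)%:R :> R.
Proof.
have [f0 f1 _ fbig] := fP => kN.
rewrite (eq_bigr (fun i => ((f i.+1 k.+1)%:R - (f i k.+1)%:R) -
                           ((f i.+1 k)%:R - (f i k)%:R))) => [|i _].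
  rewrite sumrB !telescope_sumr // !f0 [f _ k.+1]fbig //; last by lia.
  case: k kN => [|k] kN; first by rewrite f1 !subr0.
  by rewrite [f _ k.+1]fbig ?subrr //; lia.
by rewrite peak_sub_valley; ring.
Qed.

Lemma sum_staircase_term :
  \sum_(0 <= i < N.+2) \sum_(0 <= k < N.+2) staircase_term i k = N%:R.
Proof.
have [f0 f1 _ fbig] := fP.
pose p i k : R := (N.+2%:R - i%:R - k%:R) * (peak f i k)%:R.
pose v i k : R := (N%:R - i%:R - k%:R) * (valley f i k)%:R.
have p0 k : p 0%N k = 0 by rewrite /p /peak f0 mulr0.
have p1 i : p i 0%N = 0 by rewrite /p /peak f1 mulr0.
have v0 k : (k <= N.+1)%N -> v N.+1 k = 0.
  by case: k => [|k] _; rewrite /v /valley ?f1 ?[f _ k.+1]fbig ?andbF ?mulr0 //; lia.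
have v1 i : (i <= N.+1)%N -> v i N.+1 = 0.
  by case: i => [|i] _; rewrite /v /valley ?f0 ?[f i.+1 _]fbig ?andbF ?mulr0 //; lia.
under eq_bigr => i _ do rewrite sumrB.
rewrite sumrB [X in X - _]big_nat_recl // [X in _ - X]big_nat_recr //=.
rewrite [X in X + _ - _]big1 => [|k _]; last exact: p0.
rewrite [X in _ - (_ + X)]big_nat_cond [X in _ - (_ + X)]big1 => [|k kN];
  last by apply: v0; lia.
rewrite add0r addr0 -sumrB.
pose D i k : R := (peak f i.+1 k.+1)%:R - (valley f i k)%:R.
(* The weight N - i - k is split: N - i goes with the row sums and k with the column sums. Only row
   0 and column 0 survive, contributing N and 0. *)
rewrite (eq_big_nat _ _ (F2 := fun i => N%:R * (i == 0%N)%:R -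
    i%:R * (i == 0%N)%:R - \sum_(0 <= k < N.+1) k%:R * D i k)).
  rewrite !sumrB exchange_big /=.
  rewrite [X in _ - X]big1_seq => [|k]; last first.
    rewrite mem_index_iota => /= kN.
    rewrite -mulr_sumr sum_peak_sub_valley_col; last by lia.
    by case: k kN => [|k]; rewrite ?mul0r ?mulr0.
  rewrite [X in _ - X - _]big1 => [|[|i] _]; rewrite ?mul0r ?mulr0 //.
  rewrite big_nat_recl //= big1 => [|i _]; rewrite ?mulr0 //.
  by rewrite mulr1 addr0 !subr0.
move=> i iN; rewrite [X in X - _]big_nat_recl // [X in _ - X]big_nat_recr //=.
rewrite -/(p i.+1 0%N) p1 -/(v i N.+1) v1; last by lia.
rewrite add0r addr0 -sumrB -mulrBl -(@sum_peak_sub_valley_row i); last by lia.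
rewrite mulr_sumr -sumrB; apply: eq_bigr => k _.
by rewrite /D -[N.+2%:R]natr1 -[N.+1%:R]natr1 -[i.+1%:R]natr1 -[k.+1%:R]natr1; ring.
Qed.

Lemma sum_diagonal_corners : (forall i k, f i k = f k i) ->
  \sum_(0 <= i < N.+2) ((peak f i i)%:R + (valley f i i)%:R) = 1 :> R.
Proof.
have [f0 f1 mono fbig] := fP => fsym.
(* By symmetry a corner on the diagonal depends only on the increasing values at (i-1, i), (i, i),
   (i, i+1), and is present exactly when the outer two differ. *)
rewrite (eq_bigr (fun i => (f i.+1.-1 i.+1)%:R - (f i.-1 i)%:R)) => [|i _].
  by rewrite (telescope_sumr (fun i => (f i.-1 i)%:R)) //= f0 subr0 fbig //; lia.
rewrite /peak /valley [f i i.-1]fsym [f i.+1 i]fsym !andbb /=.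
have := mono i.-1 i i i (leq_pred _) (leqnn _).
have := mono i i i i.+1 (leqnn _) (leqnSn _).
case: (f i.-1 i); case: (f i i); case: (f i i.+1) => //=;
  do ?[move=> /(_ isT) //|move=> _]; ring.
Qed.
End Staircase.

(** The part below the diagonal is reflected onto the part above; the boolean [i == k] serves as the
    multiplicity 1 on the diagonal and 0 below it. *)
Lemma sum_sym_fold (V : nmodType) M (G : nat -> nat -> V) :
    (forall i k, G i k = G k i) ->
  \sum_(0 <= i < M) \sum_(0 <= k < M) G i k =
  \sum_(0 <= i < M) \sum_(0 <= k < M)
    G i k *+ (if i < k then 2 else i == k)%N.
Proof.
move=> Gsym.
transitivity (\sum_(0 <= i < M) \sum_(0 <= k < M)
                (G i k *+ (i <= k) + G i k *+ (k < i))).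
  apply: eq_bigr => i _; apply: eq_bigr => k _.
  by case: ltnP; rewrite ?mulr0n ?mulr1n ?addr0 ?add0r.
under eq_bigr => i _ do rewrite big_split.
rewrite big_split /= [X in _ + X]exchange_big -big_split /=.
apply: eq_bigr => i _; rewrite -big_split /=; apply: eq_bigr => k _.
by rewrite [G k i]Gsym -mulrnDr; congr (_ *+ _); case: ltngtP.
Qed.

(** * Posets and ideals in planar coordinates *)

Section Coordinates.
Context {d : Order.disp_t} {P : finPOrderType d}.
Variables x y : P -> nat.
Hypothesis le_xy : forall p q : P, (p <= q)%O = (x q <= x p)%N && (y q <= y p)%N.

Lemma coord_inj p q : x p = x q -> y p = y q -> p = q.
Proof. by move=> xx yy; apply/eqP; rewrite eq_le !le_xy xx yy !leqnn. Qed.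

Lemma sum_coord (V : nmodType) (M : nat) (r : nat -> nat -> bool)
    (G : nat -> nat -> V) :
    (forall p, [&& (x p < M)%N, (y p < M)%N & r (x p) (y p)]) ->
    (forall i k, (i < M)%N -> (k < M)%N -> r i k -> exists p, x p = i /\ y p = k) ->
    (forall i k, ~~ r i k -> G i k = 0) ->
  \sum_(0 <= i < M) \sum_(0 <= k < M) G i k = \sum_p G (x p) (y p).
Proof.
move=> xyM surj G0.
have xM p : (x p < M)%N by case/and3P: (xyM p).
have yM p : (y p < M)%N by case/and3P: (xyM p).
pose c p := (Ordinal (xM p), Ordinal (yM p)).
have c_inj : {in P &, injective c}.
  by move=> p q _ _ [xx yy]; apply: coord_inj.
under eq_bigr => i _ do rewrite big_mkord.
rewrite big_mkord pair_big -(big_imset (fun u : 'I_M * 'I_M => G u.1 u.2) c_inj) /=.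
rewrite [RHS]big_mkcond; apply: eq_bigr => -[i k] _ /=.
case: imsetP => // nex; apply: G0; apply/negP => rik.
have [p [px py]] := surj i k (ltn_ord i) (ltn_ord k) rik.
by case: nex; exists p => //; congr pair; apply: val_inj.
Qed.

(* Extends the indicator of [I] monotonically to all positions: it is vacuously
   true at positions with no element of the poset below them. *)
Definition below_in (I : 'J(P)) i k : bool :=
  [forall q, (i <= x q)%N && (k <= y q)%N ==> (q \in I)].

Lemma below_inP (I : 'J(P)) i k :
  reflect (forall q, (i <= x q)%N -> (k <= y q)%N -> q \in I) (below_in I i k).
Proof.
apply: (iffP forallP) => [h q iq kq|h q]; first by have := h q; rewrite iq kq.
by apply/implyP => /andP[]; apply: h.
Qed.

Lemma below_in_coord (I : 'J(P)) p : below_in I (x p) (y p) = (p \in I).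
Proof.
apply/below_inP/idP => [|pI q xq yq]; first exact.
by apply: ideal_le pI _; rewrite le_xy xq.
Qed.

Lemma below_in_mono (I : 'J(P)) i k i' k' : (i <= i')%N -> (k <= k')%N ->
  below_in I i k -> below_in I i' k'.
Proof.
move=> ii kk /below_inP h; apply/below_inP => q iq kq.
by apply: h; [apply: leq_trans iq|apply: leq_trans kq].
Qed.
End Coordinates.

(** * Type A *)

Section TypeA.
Variable n : nat.
Implicit Types p q : PhiA n.

(* The second coordinate is reversed, so that the order of type A becomes the
   reversed componentwise order, as in type B. *)
Definition xA p : nat := (val p).1.
Definition yA p : nat := (n.+1 - (val p).2)%N.

Lemma le_xyA p q : (p <= q)%O = (xA q <= xA p)%N && (yA q <= yA p)%N.
Proof.
have := ltn_ord (val p).2; have := ltn_ord (val q).2; rewrite /xA /yA => q2 p2.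
by rewrite [LHS]/(leA p q) /leA; congr andb; lia.
Qed.

Lemma xyA_bounds p : [&& (0 < xA p)%N, (0 < yA p)%N & (xA p + yA p <= n.+1)%N].
Proof. by have := valP p; have := ltn_ord (val p).2; rewrite /xA /yA; lia. Qed.

Lemma xyA_surj i k : (0 < i)%N -> (0 < k)%N -> (i + k <= n.+1)%N ->
  exists p, xA p = i /\ yA p = k.
Proof.
move=> i0 k0 ik.
have iP : (i < n.+1)%N by lia.
have jP : (n.+1 - k < n.+1)%N by lia.
have pP : (0 < Ordinal iP <= Ordinal jP)%N by rewrite /=; lia.
by exists (exist _ (Ordinal iP, Ordinal jP) pP); rewrite /xA /yA /=; lia.
Qed.

(** The guards keep the axes empty, where [below_in] alone may hold, for instance when [I] is the
    whole poset. *)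
Definition regionA (I : 'J(PhiA n)) i k : bool :=
  [&& (0 < i)%N, (0 < k)%N & below_in xA yA I i k].

Lemma regionAP I : staircase_region n (regionA I).
Proof.
split=> [k|i|i k i' k' ii kk|i k i0 k0 ik]; rewrite /regionA ?andbF //.
  move=> /and3P[i0 k0 h]; rewrite (below_in_mono ii kk h).
  by rewrite (leq_trans i0 ii) (leq_trans k0 kk).
rewrite i0 k0; apply/below_inP => q iq kq.
by have := xyA_bounds q; lia.
Qed.

Lemma removableA I p : removable p I = peak (regionA I) (xA p) (yA p).
Proof.
have /and3P[xp yp xyp] := xyA_bounds p.
have mem_region q : q \in I -> regionA I (xA q) (yA q).
  by have /and3P[xq yq _] := xyA_bounds q; rewrite /regionA xq yq (below_in_coord le_xyA).
have region_mem i k : regionA I i k -> (i + k <= n.+1)%N ->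
    exists q, [/\ q \in I, xA q = i & yA q = k].
  move=> /and3P[i0 k0 h] ik; have [q [qi qk]] := xyA_surj i0 k0 ik.
  by exists q; rewrite -(below_in_coord le_xyA) qi qk.
have [_ _ mono _] := regionAP I.
apply/removableP/and3P => [[pI pmax]|[pR nx ny]].
  split; first exact: mem_region.
    apply/negP => /region_mem[|q [qI qx qy]]; first by lia.
    have := pmax q qI; rewrite le_xyA qx qy leq_pred leqnn => /(_ isT) qp.
    by move: qx; rewrite qp; lia.
  apply/negP => /region_mem[|q [qI qx qy]]; first by lia.
  have := pmax q qI; rewrite le_xyA qx qy leq_pred leqnn => /(_ isT) qp.
  by move: qy; rewrite qp; lia.
split=> [|q /mem_region qR].
  by rewrite -(below_in_coord le_xyA); case/and3P: pR.
(* An element of [I] strictly above [p] has a smaller coordinate, so by monotonicity a predecessor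
   cell of [p] would lie in the region. *)
rewrite le_xyA => /andP[xq yq]; apply: (coord_inj le_xyA).
  apply/eqP; rewrite eqn_leq xq leqNgt; apply: contra nx => lt.
  by apply: mono qR; lia.
apply/eqP; rewrite eqn_leq yq leqNgt; apply: contra ny => lt.
by apply: mono qR; lia.
Qed.

(** A successor cell that is not in the poset lies past the antidiagonal, where [below_in] holds
    vacuously, so minimal elements need no separate case. *)
Lemma addableA I p : addable p I = valley (regionA I) (xA p) (yA p).
Proof.
have /and3P[xp yp xyp] := xyA_bounds p.
rewrite /valley /regionA xp yp (below_in_coord le_xyA) /=.
apply/addableP/and3P => [[pI pmin]|[pI /below_inP hx /below_inP hy]].
  split=> //; apply/below_inP => q xq yq; apply: pmin.
  - by rewrite le_xyA; lia.
  - by apply: contraTneq xq => ->; lia.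
  - by rewrite le_xyA; lia.
  - by apply: contraTneq yq => ->; lia.
split=> // q; rewrite le_xyA => /andP[xq yq] qp.
have [lt|ge] := ltnP (xA p) (xA q); first exact: hx.
have [lt'|ge'] := ltnP (yA p) (yA q); first exact: hy.
case/eqP: qp; apply: (coord_inj le_xyA); lia.
Qed.

Lemma tCDE_A (R : realType) : tCDE R (PhiA n).
Proof.
apply: (@tCDE_criterion R _ _ 2 n%:R (fun p => n%:R - (xA p)%:R - (yA p)%:R)).
  by rewrite pnatr_eq0.
move=> I; rewrite -[X in X + _](sum_staircase_term R (regionAP I)).
rewrite (sum_coord le_xyA
  (r := fun i k => [&& (0 < i)%N, (0 < k)%N & (i + k <= n.+1)%N])).
- rewrite mulr_sumr -big_split /=; apply: eq_bigr => p _.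
  by rewrite /staircase_term removableA addableA -[n.+2%:R]natr1 -[n.+1%:R]natr1; ring.
- by move=> p; have := xyA_bounds p; lia.
- by move=> i k _ _ /and3P[]; apply: xyA_surj.
- by move=> i k; apply: staircase_term_out; apply: regionAP.
Qed.
End TypeA.

(** * Type B *)

Section TypeB.
Variable n : nat.
Implicit Types p q : PhiB n.

Definition xB p : nat := (val p).1.
Definition yB p : nat := (val p).2.

Lemma le_xyB p q : (p <= q)%O = (xB q <= xB p)%N && (yB q <= yB p)%N.
Proof. by []. Qed.

Lemma xyB_bounds p : [&& (0 < xB p)%N, (xB p <= yB p)%N & (xB p + yB p <= 2 * n)%N].
Proof. by have := valP p; have := ltn_ord (val p).1; rewrite /xB /yB; lia. Qed.

Lemma xyB_surj i k : (0 < i)%N -> (i <= k)%N -> (i + k <= 2 * n)%N ->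
  exists p, xB p = i /\ yB p = k.
Proof.
move=> i0 k0 ik.
have iP : (i < n.+1)%N by lia.
have jP : (k < (2 * n).+1)%N by lia.
have pP : (1 <= Ordinal iP)%N && (Ordinal iP <= Ordinal jP <= 2 * n - Ordinal iP)%N.
  by rewrite /=; lia.
by exists (exist _ (Ordinal iP, Ordinal jP) pP).
Qed.

(* Reflection in the diagonal turns an ideal of type B_n into a symmetric ideal
   of type A_(2n-1). *)
Definition regionB (I : 'J(PhiB n)) i k : bool :=
  [&& (0 < i)%N, (0 < k)%N & below_in xB yB I (minn i k) (maxn i k)].

Lemma regionB_sym I i k : regionB I i k = regionB I k i.
Proof. by rewrite /regionB minnC maxnC andbCA. Qed.

Lemma regionBP I : staircase_region (2 * n).-1 (regionB I).
Proof.
split=> [k|i|i k i' k' ii kk|i k i0 k0 ik]; rewrite /regionB ?andbF //.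
  move=> /and3P[i0 k0 h]; rewrite (leq_trans i0 ii) (leq_trans k0 kk) /=.
  by apply: below_in_mono h; lia.
rewrite i0 k0; apply/below_inP => q iq kq.
by have := xyB_bounds q; lia.
Qed.

Lemma regionB_coord I p : regionB I (xB p) (yB p) = (p \in I).
Proof.
have := xyB_bounds p => /and3P[x0 xy _].
rewrite /regionB x0 (leq_trans x0 xy) (minn_idPl xy) (maxn_idPr xy).
exact: below_in_coord le_xyB _ _.
Qed.

(** As in type A, except that a predecessor cell of a diagonal element may fall below the diagonal;
    it then stands for its mirror image, whence [minn] and [maxn]. *)
Lemma removableB I p : removable p I = peak (regionB I) (xB p) (yB p).
Proof.
have /and3P[xp xyp sxyp] := xyB_bounds p.
have region_mem i k : regionB I i k -> (i + k <= 2 * n)%N ->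
    exists q, [/\ q \in I, xB q = minn i k & yB q = maxn i k].
  move=> /and3P[i0 k0 h] ik.
  have [|||q [qi qk]] := @xyB_surj (minn i k) (maxn i k); [lia..|].
  by exists q; rewrite -(below_in_coord le_xyB) qi qk.
have [_ _ mono _] := regionBP I.
rewrite /peak regionB_coord; apply/removableP/and3P => [[pI pmax]|[pI nx ny]].
  split=> //; apply/negP => /region_mem[|q [qI qx qy]]; try lia;
    have := pmax q qI; rewrite le_xyB; move=> h;
    have qp : q = p by apply: h; lia.
    by move: qx qy; rewrite qp; lia.
  by move: qx qy; rewrite qp; lia.
split=> // q; rewrite -regionB_coord => qR.
rewrite le_xyB => /andP[xq yq]; apply: (coord_inj le_xyB).
  apply/eqP; rewrite eqn_leq xq leqNgt; apply: contra nx => lt.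
  by apply: mono qR; lia.
apply/eqP; rewrite eqn_leq yq leqNgt; apply: contra ny => lt.
by apply: mono qR; lia.
Qed.

Lemma addableB I p : addable p I = valley (regionB I) (xB p) (yB p).
Proof.
have /and3P[xp xyp sxyp] := xyB_bounds p.
rewrite /valley regionB_coord /regionB /= xp (leq_trans xp xyp) /=.
apply/addableP/and3P => [[pI pmin]|[pI /below_inP hx /below_inP hy]].
  split=> //; apply/below_inP => q xq yq; (apply: pmin; first by rewrite le_xyB; lia).
    by apply/eqP => qp; rewrite qp in xq yq; lia.
  by apply/eqP => qp; rewrite qp in xq yq; lia.
split=> // q; rewrite le_xyB => /andP[xq yq] qp.
have /and3P[x0q xyq _] := xyB_bounds q.
have [lt'|ge'] := ltnP (yB p) (yB q); first by apply: hy; lia.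
have [lt|ge] := ltnP (xB p) (xB q); first by apply: hx; lia.
by case/eqP: qp; apply: (coord_inj le_xyB); lia.
Qed.

Lemma tCDE_B (R : realType) : (1 <= n)%N -> tCDE R (PhiB n).
Proof.
move=> n0; pose N := (2 * n).-1.
(* Folding the type A_N identity counts off-diagonal elements twice, giving 4 per peak, but diagonal
   ones once, giving 2. Adding peak + valley = 2 peak + (valley - peak) on the diagonal restores the
   4, lowers the coefficient there by 1 and raises the constant to N + 1. *)
pose c p : R := if xB p == yB p then N%:R - 1 - (xB p)%:R - (yB p)%:R
                else 2 * (N%:R - (xB p)%:R - (yB p)%:R).
apply: (@tCDE_criterion R _ _ 4 (N%:R + 1) c); first by rewrite pnatr_eq0.
move=> I; have fP := regionBP I; have fsym := regionB_sym I.
set f := regionB I in fP fsym.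
pose G i k : R := staircase_term R N f i k +
  (if i == k then (peak f i k)%:R + (valley f i k)%:R else 0).
have GE : \sum_(0 <= i < N.+2) \sum_(0 <= k < N.+2) G i k = N%:R + 1.
  under eq_bigr => i _ do rewrite big_split.
  rewrite big_split /= (sum_staircase_term R fP).
  rewrite -[X in _ = _ + X](sum_diagonal_corners R fP fsym).
  congr (_ + _); apply: eq_big_nat => i iN.
  rewrite (bigD1_seq i) ?iota_uniq ?mem_index_iota //= eqxx.
  rewrite [X in _ + X]big1 ?addr0 // => k.
  by rewrite eq_sym => /negPf ->.
have Gsym i k : G i k = G k i.
  rewrite /G /staircase_term.
  have -> : peak f i k = peak f k i.
    rewrite /peak [f i k]fsym [f i.-1 k]fsym [f i k.-1]fsym.
    by congr andb; rewrite andbC.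
  have -> : valley f i k = valley f k i.
    rewrite /valley [f i k]fsym [f i.+1 k]fsym [f i k.+1]fsym.
    by congr andb; rewrite andbC.
  by rewrite eq_sym; congr (_ + _); ring.
rewrite -GE (sum_sym_fold _ Gsym).
rewrite (sum_coord le_xyB
  (r := fun i k => [&& (0 < i)%N, (i <= k)%N & (i + k <= 2 * n)%N])).
- rewrite mulr_sumr -big_split /=; apply: eq_bigr => p _.
  have /and3P[_ xy _] := xyB_bounds p.
  rewrite removableB addableB /c /G /staircase_term -/f -[N.+2%:R]natr1 -[N.+1%:R]natr1.
  have [xyE|nxy] := eqVneq (xB p) (yB p); first by rewrite xyE ltnn mulr1n; ring.
  by rewrite ltn_neqAle nxy xy /= addr0; ring.
- by move=> p; have := xyB_bounds p; lia.
- by move=> i k _ _ /and3P[]; apply: xyB_surj.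
- move=> i k h; case: ltngtP => ik; rewrite ?mulr0n //.
    rewrite /G (staircase_term_out _ fP); last by lia.
    by rewrite (ltn_eqF ik) addr0 mul0rn.
  rewrite -ik in h *; rewrite mulr1n /G (staircase_term_out _ fP); last by lia.
  (* The diagonal correction must vanish too: i + k = N + 2 = 2n + 1 is odd, so the outermost peaks,
     which have weight 0 in [staircase_term], are never on the diagonal. *)
  have [f0 _ _ fbig] := fP; rewrite eqxx add0r /peak /valley.
  case: i h {ik} => [|i] h; first by rewrite !f0 /= addr0.
  rewrite [f i.+1 i.+1]fbig //= ?[f i i.+1]fbig /= ?addr0 //; rewrite /N; lia.
Qed.
End TypeB.

Local Close Scope ring_scope.

Theorem theorem3p8 (R : realType) :
  [/\ forall n : nat, 1 <= n -> tCDE R (PhiA n),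
      forall n : nat, 1 <= n -> tCDE R (PhiB n),
      tCDE R PhiH3
    & forall m : nat, 2 <= m -> tCDE R (PhiI2 m)].
Proof.
split=> [n _|n n0||m _].
- exact: tCDE_A.
- exact: tCDE_B.
- exact: tCDE_H3.
- exact: tCDE_I2.
Qed.
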